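(* Let $(X,T)$ be a uniquely ergodic topological dynamical system. Then $(X,T)$ is not Bohr chaotic.
   Context: A topological dynamical system $(X,T)$ is a compact metric space $X$ together with a continuous map $T:X\to X$; it is uniquely ergodic if it has exactly one $T$-invariant Borel probability measure. $C(X)$ is the space of continuous complex-valued functions on $X$. A (non-trivial) weight is a bounded sequence of complex numbers $(w_n)_{n\ge 0}$ with $\limsup_{N\to\infty}\frac1N\sum_{n=0}^{N-1}|w_n|>0$. The system $(X,T)$ is Bohr chaotic if for every non-trivial weight $(w_n)_{n\ge0}$ there exist $f\in C(X)$ and $x\in X$ such that $\limsup_{N\to\infty}\frac1N\left|\sum_{n=0}^{N-1}w_nf(T^nx)\right|>0$. *)

(* Defs.v *)
From HB Require Import structures.
From mathcomp Require Import all_boot all_order all_algebra.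
From mathcomp Require Import all_classical all_reals all_analysis.
From mathcomp Require Import complex.

Set Implicit Arguments.
Unset Strict Implicit.
Unset Printing Implicit Defensive.

Import Order.TTheory GRing.Theory Num.Theory.
Import numFieldNormedType.Exports.

Local Open Scope classical_set_scope.
Local Open Scope ring_scope.

(* Measurable types are pointed in the library, so the Borel sigma-algebra is
   only available on a pointed metric space.  Nothing is lost: a system with an
   invariant probability measure is nonempty, and no notion below depends on
   the distinguished point. *)
#[short(type="pmetricType")]
HB.structure Definition PointedMetric (R : numDomainType) :=
  {X of Pointed X & Metric R X}.

Notation modC := ComplexField.Normc.normc.

Notation borelType X := (g_sigma_algebraType (@open X)).

Section BohrChaos.
Context {R : realType}.

Definition invariant_measure (X : pmetricType R) (T : X -> X)
    (mu : probability (borelType X) R) : Prop :=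
  forall A : set (borelType X), measurable A ->
    pushforward mu (T : borelType X -> borelType X) A = mu A.

(* A library measure is a function on all subsets that is only constrained on
   the measurable ones, hence uniqueness is agreement on Borel sets. *)
Definition uniquely_ergodic (X : pmetricType R) (T : X -> X) : Prop :=
  exists2 mu : probability (borelType X) R, invariant_measure T mu &
    forall nu : probability (borelType X) R, invariant_measure T nu ->
      forall A : set (borelType X), measurable A -> nu A = mu A.

(* The limit superior is taken in the extended reals; the term N = 0 is 0. *)
Definition nontrivial_weight (w : nat -> R[i]) : Prop :=
  (exists M : R, forall n, modC (w n) <= M) /\
  (0 < limn_esup (fun N => (N%:R^-1 * \sum_(0 <= n < N) modC (w n))%:E))%E.

(* R[i]^o is R[i] with the topology of its modulus. *)
Definition bohr_chaotic (X : pmetricType R) (T : X -> X) : Prop :=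
  forall w : nat -> R[i], nontrivial_weight w ->
    exists (f : X -> R[i]^o) (x : X), continuous f /\
      (0 < limn_esup (fun N =>
         (N%:R^-1 * modC (\sum_(0 <= n < N) w n * (f (iter n T x) : R[i])))%:E))%E.

End BohrChaos.

(* Main.v *)
(* The weight is the sign w(n) = (-1)^floor(sqrt n), which is constant on the
   blocks [j^2, (j+1)^2): it has mean zero, and its total variation up to N is
   O(sqrt N).  For both signs, c = 1 +/- w is a nonnegative weight of mean 1 and
   vanishing average variation, so along any ultrafilter on the integers the limit
   of (1/N) sum_{n<N} c(n) g(T^n x) is a T-invariant mean on bounded functions g.
   Restricted to indicators, an invariant mean is a finitely additive invariant
   probability, whose regularization is an invariant Borel probability (the
   compactness of X gives countable additivity), hence the unique one.  It bounds
   the mean from above on closed sets and from below on open sets, which by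
   slicing along level sets determines the mean on continuous functions.  So both
   signs give the same value, and the averages of w(n) f(T^n x) tend to 0. *)
Require Import Defs.
From HB Require Import structures.
From mathcomp Require Import all_boot all_order all_algebra.
From mathcomp Require Import all_classical all_reals all_analysis.
From mathcomp Require Import complex zify ring lra.

Set Implicit Arguments.
Unset Strict Implicit.
Unset Printing Implicit Defensive.

Import Order.TTheory GRing.Theory Num.Theory.
Import numFieldNormedType.Exports.

Local Open Scope classical_set_scope.
Local Open Scope ring_scope.

(** * From finitely additive to Borel measures *)

Section RegularizedMeasure.
Context {R : realType} {X : pmetricType R} (P : set X -> R).
Hypothesis Xcompact : compact [set: X].
Hypothesis P_ge0 : forall A, 0 <= P A.
Hypothesis P_setT : P setT = 1.
Hypothesis P_setU : forall A B, A `&` B = set0 -> P (A `|` B) = P A + P B.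

(* [P] is only finitely additive; its regularization, from inside by closed sets
   and then from outside by open sets, is an outer measure for which Borel sets are measurable. *)
Definition inner_mass (U : set X) : \bar R :=
  ereal_sup [set (P K)%:E | K in [set K | closed K /\ K `<=` U]].

Definition outer_mass (A : set X) : \bar R :=
  ereal_inf [set inner_mass U | U in [set U | open U /\ A `<=` U]].

Lemma additive_set0 : P set0 = 0.
Proof. by have := P_setU (setI0 set0); rewrite setU0; lra. Qed.

Lemma additive_le A B : A `<=` B -> P A <= P B.
Proof.
move=> AB; rewrite -(setDUK AB) P_setU ?lerDl//.
by rewrite setDE setICA setICr setI0.
Qed.

Lemma additive_setU_le A B : P (A `|` B) <= P A + P B.
Proof.
have -> : A `|` B = A `|` (B `\` A) by rewrite setUDr setDv setD0.
rewrite P_setU; last by rewrite setDE setICA setICr setI0.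
by rewrite lerD2l additive_le// => x [].
Qed.

Lemma le_inner_mass K U : closed K -> K `<=` U -> ((P K)%:E <= inner_mass U)%E.
Proof. by move=> cK KU; apply: ereal_sup_ubound; exists K. Qed.

Lemma inner_mass_le U : (inner_mass U <= (P U)%:E)%E.
Proof.
by apply: ge_ereal_sup => _ [K [_ KU] <-]; rewrite lee_fin additive_le.
Qed.

Lemma inner_mass_ge0 U : (0 <= inner_mass U)%E.
Proof.
by rewrite -[leLHS]/(0%:E) -additive_set0; apply: le_inner_mass => //; exact: closed0.
Qed.

Lemma outer_mass_open U : open U -> outer_mass U = inner_mass U.
Proof.
move=> oU; apply/eqP; rewrite eq_le; apply/andP; split.
  by apply: ereal_inf_lbound; exists U => //; split.
apply: le_ereal_inf_tmp => _ [V [oV UV] <-]; apply: ge_ereal_sup => _ [K [cK KU] <-].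
by apply: le_inner_mass => //; exact: subset_trans UV.
Qed.

Lemma le_outer_mass_closed F : closed F -> ((P F)%:E <= outer_mass F)%E.
Proof.
by move=> cF; apply: le_ereal_inf_tmp => _ [U [oU FU] <-]; exact: le_inner_mass.
Qed.

Lemma outer_mass_setT : outer_mass setT = 1%E.
Proof.
rewrite outer_mass_open; last exact: openT.
apply/eqP; rewrite eq_le -[1%E]/(1%:E) -P_setT inner_mass_le.
by rewrite le_inner_mass//; exact: closedT.
Qed.

Lemma outer_mass0 : outer_mass set0 = 0%E.
Proof.
rewrite outer_mass_open; last exact: open0.
by apply/eqP; rewrite eq_le inner_mass_ge0 -[0%E]/(0%:E) -additive_set0 inner_mass_le.
Qed.

Lemma outer_mass_ge0 A : (0 <= outer_mass A)%E.
Proof. by apply: le_ereal_inf_tmp => _ [U [oU AU] <-]; exact: inner_mass_ge0. Qed.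

Lemma le_outer_mass : {homo outer_mass : A B / A `<=` B >-> (A <= B)%E}.
Proof.
move=> A B AB; apply: ereal_inf_le_tmp => _ [U [oU BU] <-].
by exists U => //; split => //; exact: subset_trans BU.
Qed.

Lemma outer_mass_fin_num A : outer_mass A \is a fin_num.
Proof.
rewrite ge0_fin_numE ?outer_mass_ge0//.
by rewrite (le_lt_trans (le_outer_mass (@subsetT _ A)))// outer_mass_setT ltry.
Qed.

(** Normality separates the disjoint closed sets [K \ V] and [K \ U] by disjoint open [W1] and [W2].
    Removing [W2] from [K] leaves only points of [U], removing [W1] leaves only points of [V], and
    nothing is lost from both pieces at once because [W1] and [W2] are disjoint. *)
Lemma closed_split (K U V : set X) : closed K -> open U -> open V -> K `<=` U `|` V ->
  exists K1 K2, [/\ closed K1, closed K2, K1 `<=` U, K2 `<=` V & K = K1 `|` K2].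
Proof.
move=> cK oU oV KUV.
have /(@normal_openP R) nX := compact_normal (@metric_hausdorff _ X) Xcompact.
have [|||W1 [W2 [oW1 oW2 KVW1 KUW2 W120]]] := nX (K `\` V) (K `\` U).
- by apply: closedI => //; exact: open_closedC.
- by apply: closedI => //; exact: open_closedC.
- by rewrite -subset0 => x [[Kx nVx] [_ nUx]]; case: (KUV x Kx).
exists (K `\` W2), (K `\` W1); split.
- by apply: closedI => //; exact: open_closedC.
- by apply: closedI => //; exact: open_closedC.
- by move=> x [Kx nW2x]; apply: contrapT => nUx; apply/nW2x/KUW2.
- by move=> x [Kx nW1x]; apply: contrapT => nVx; apply/nW1x/KVW1.
- by rewrite -setDIr setIC W120 setD0.
Qed.

(** Induction on the number of open sets: [closed_split] detaches from [K] a closed piece lying in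
    the last one. *)
Lemma le_sum_inner_mass (U : (set X)^nat) m K : (forall n, open (U n)) ->
  closed K -> K `<=` \bigcup_(n < m) U n ->
  ((P K)%:E <= \sum_(0 <= n < m) inner_mass (U n))%E.
Proof.
move=> oU; elim: m K => [|m ih] K cK.
  by rewrite bigcup_mkord big_ord0 subset0 => ->; rewrite big_geq// additive_set0.
rewrite bigcup_mkord big_ord_recr/= -bigcup_mkord.
case/closed_split => //; first by apply: bigcup_open.
move=> K1 [K2 [cK1 cK2 K1U K2U ->]].
rewrite big_nat_recr//= (@le_trans _ _ (P K1 + P K2)%:E)%E//.
  by rewrite lee_fin additive_setU_le.
by rewrite EFinD leeD// ?ih// le_inner_mass.
Qed.

(** This is where compactness turns finite additivity into countable subadditivity: each closed [K]
    in the union is already covered by finitely many of the sets. *)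
Lemma inner_mass_bigcup (U : (set X)^nat) : (forall n, open (U n)) ->
  (inner_mass (\bigcup_n U n) <= \sum_(n <oo) inner_mass (U n))%E.
Proof.
move=> oU; apply: ge_ereal_sup => _ [K [cK KU] <-].
have [m KUm] : exists m, K `<=` \bigcup_(n < m) U n.
  have /compact_near_coveringP/near_covering_withinP := subclosed_compact cK Xcompact (@subsetT _ K).
  (* Each point of [K] has a neighbourhood inside the first [m] sets for all large [m]; the
     near-covering form of compactness makes [m] uniform over [K]. *)
  move=> /(_ nat \oo (fun m x => (\bigcup_(n < m) U n) x)) [].
    move=> x Kx; have [n _ Unx] := KU x Kx.
    exists (U n, [set m | (n < m)%N]) => /=.
      by split; [exact: open_nbhs_nbhs|exact: nbhs_infty_gt].
    by move=> [y m] [/= Uny nm] _; exists n.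
  by move=> m _ /(_ m (leqnn _)) Km; exists m.
apply: le_trans (le_sum_inner_mass oU cK KUm) _.
by apply: nneseries_lim_ge => n _ _; exact: inner_mass_ge0.
Qed.

Lemma outer_mass_sigma_subadditive : sigma_subadditive outer_mass.
Proof.
move=> A; apply/lee_addgt0Pr => e e0.
apply: le_trans (epsilon_trick _ _ (ltW e0)); last by move=> n; exact: outer_mass_ge0.
have /choice[U UP] : forall n, exists U, [/\ open U, A n `<=` U &
    (inner_mass U <= outer_mass (A n) + (e / (2 ^ n.+1)%:R)%:E)%E].
  move=> n; have en : 0 < e / (2 ^ n.+1)%:R by rewrite divr_gt0// ltr0n expn_gt0.
  have [_ [U [oU AU] <-] /ltW UA] := lb_ereal_inf_adherent en (outer_mass_fin_num (A n)).
  by exists U.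
apply: (@le_trans _ _ (inner_mass (\bigcup_n U n))).
  apply: ereal_inf_lbound; exists (\bigcup_n U n) => //; split.
    by apply: bigcup_open => n _; have [] := UP n.
  by apply: subset_bigcup => n _; have [] := UP n.
apply: le_trans (inner_mass_bigcup _) _; first by move=> n; have [] := UP n.
apply: lee_nneseries => [n _ _|n _]; first exact: inner_mass_ge0.
by have [] := UP n.
Qed.

HB.instance Definition _ := isOuterMeasure.Build R X outer_mass
  outer_mass0 outer_mass_ge0 le_outer_mass outer_mass_sigma_subadditive.

(** For an open [U] containing [A], take a closed [K] inside [U] and [V], then a closed [L] inside
    [U] minus [K]. Being disjoint, they satisfy [P K + P L = P (K | L)], which is at most the inner
    mass of [U]; suprema over [L] and then [K] give the Caratheodory inequality. *)
Lemma open_caratheodory (V : set X) : open V -> outer_mass.-caratheodory V.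
Proof.
move=> oV; apply: le_caratheodory_measurable => A.
apply: le_ereal_inf_tmp => _ [U [oU AU] <-].
apply: (@le_trans _ _ (inner_mass (U `&` V) + outer_mass (U `\` V))%E).
  rewrite -(outer_mass_open (openI oU oV)); apply: leeD; apply: le_outer_mass; exact: setSI.
rewrite -leeBrDr ?outer_mass_fin_num//; apply: ge_ereal_sup => _ [K [cK KUV] <-].
rewrite leeBrDr ?outer_mass_fin_num// addeC -leeBrDr//.
(* [U] minus [V] need not be open; it is enlarged to [U] minus [K], whose outer mass is a supremum
   over closed sets. *)
have oUK : open (U `\` K) by apply: openI => //; exact: closed_openC.
apply: (@le_trans _ _ (inner_mass (U `\` K))).
  rewrite -(outer_mass_open oUK); apply: le_outer_mass => x [Ux nVx].
  by split => // /KUV[].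
apply: ge_ereal_sup => _ [L [cL LUK] <-].
rewrite leeBrDr// -EFinD addrC -P_setU; last first.
  by rewrite -subset0 => x [Kx /LUK[_]].
apply: le_inner_mass; first exact: closedU.
by move=> x [/KUV[]|/LUK[]].
Qed.

Lemma borel_caratheodory (A : set (borelType X)) :
  measurable A -> outer_mass.-caratheodory A.
Proof.
move: A; apply: smallest_sub => [|V oV]; last exact: open_caratheodory.
split.
- exact: caratheodory_measurable_set0.
- by move=> A mA; rewrite setTD; exact: caratheodory_measurable_setC.
- exact: caratheodory_measurable_bigcup.
Qed.

Lemma exists_regularized_measure : exists nu : probability (borelType X) R,
  (forall U : set X, open U -> nu U = inner_mass U) /\
  (forall F : set X, closed F -> ((P F)%:E <= nu F)%E).
Proof.
pose m : set (borelType X) -> \bar R := outer_mass.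
have m_sa : semi_sigma_additive m.
  move=> F mF tF mUF; apply: (@caratheodory_measure_sigma_additive _ _ outer_mass) => //.
    by move=> n; exact: borel_caratheodory.
  exact: borel_caratheodory.
pose c := isMeasure.Build _ (borelType X) R m outer_mass0 outer_mass_ge0 m_sa.
pose nu0 : {measure set (borelType X) -> \bar R} := HB.pack m c.
pose d := Measure_isProbability.Build _ (borelType X) R nu0 outer_mass_setT.
pose nu : probability (borelType X) R := HB.pack m c d.
exists nu; split; first exact: outer_mass_open.
exact: le_outer_mass_closed.
Qed.

End RegularizedMeasure.

Section UniquelyErgodic.
Context {R : realType}.

(** * Invariance of the regularized measure *)

Lemma continuous_borel_measurable (X : pmetricType R) (T : X -> X) :
  continuous T -> measurable_fun setT (T : borelType X -> borelType X).
Proof.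
move=> /continuousP cT; apply: (@measurability _ _ (borelType X) (borelType X) setT _ (@open X)) => //.
by move=> _ [U oU <-]; rewrite setTI; apply: sub_sigma_algebra; exact: cT.
Qed.

(** A closed [K] inside the preimage is compact, so its image is a closed subset of [U], and [K]
    lies in the preimage of that image. Conversely, closed subsets of [U] pull back to closed sets
    of the same mass. *)
Lemma inner_mass_preimage (X : pmetricType R) (T : X -> X) (P : set X -> R) :
  compact [set: X] -> continuous T ->
  (forall A B, A `<=` B -> P A <= P B) -> (forall A, P (T @^-1` A) = P A) ->
  forall U, inner_mass P (T @^-1` U) = inner_mass P U.
Proof.
move=> Xcompact cT Ple PT U; apply/eqP; rewrite eq_le; apply/andP; split.
  apply: ge_ereal_sup => _ [K [cK KU] <-].
  apply: (@le_trans _ _ (P (T @` K))%:E).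
    by rewrite lee_fin -(PT (T @` K)); apply: Ple; exact: preimage_image.
  apply: le_inner_mass; last by move=> _ [x /KU ? <-].
  apply: compact_closed; first exact: metric_hausdorff.
  apply: continuous_compact; first exact: continuous_subspaceT.
  by apply: subclosed_compact cK Xcompact _.
apply: ge_ereal_sup => _ [K [cK KU] <-]; rewrite -PT.
apply: le_inner_mass; last by move=> x /KU.
by move/continuous_closedP : cT; exact.
Qed.

Lemma exists_invariant_measure (X : pmetricType R) (T : X -> X) (P : set X -> R) :
  compact [set: X] -> continuous T -> (forall A, 0 <= P A) -> P setT = 1 ->
  (forall A B, A `&` B = set0 -> P (A `|` B) = P A + P B) ->
  (forall A, P (T @^-1` A) = P A) ->
  exists2 nu : probability (borelType X) R, invariant_measure T nu &
    (forall F : set X, closed F -> ((P F)%:E <= nu F)%E) /\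
    (forall U : set X, open U -> (nu U <= (P U)%:E)%E).
Proof.
move=> Xcompact cT P_ge0 P_setT P_setU PT.
have [nu [nuU nuF]] := exists_regularized_measure Xcompact P_ge0 P_setT P_setU.
exists nu; last by split=> // U oU; rewrite nuU//; exact: inner_mass_le.
pose TB : {mfun borelType X >-> borelType X} :=
  mfun_Sub (mem_set (continuous_borel_measurable cT)).
(* Open sets are stable under intersection and generate the Borel sets, so it suffices to compare
   the pushforward with [nu] on them, where both are inner masses. *)
apply: (@measure_unique _ _ (borelType X) (@open X) (fun=> setT) _ _ _ _
  (pushforward nu TB) nu) => //.
- exact: openI.
- by move=> _; exact: openT.
- by rewrite bigcup_const.
- move=> U oU; transitivity (inner_mass P (T @^-1` U)).
    by apply: nuU; move/continuousP : (cT); exact.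
  rewrite inner_mass_preimage//; first exact/esym/nuU.
  exact: additive_le.
- move=> _; change (nu setT < +oo)%E.
  by rewrite probability_setT ltry.
Qed.

(** * Invariant means *)

Definition bounded_valued (X : Type) (f : X -> R) := exists B, forall x, `|f x| <= B.

(* Only bounded functions are constrained: on the others an ultralimit is a junk value. *)
Record invariant_mean (X : Type) (T : X -> X) (M : (X -> R) -> R) : Prop := {
  mean_cst1 : M (fun=> 1) = 1;
  mean_linear : forall a f g, bounded_valued f -> bounded_valued g ->
    M (fun x => a * f x + g x) = a * M f + M g;
  mean_le : forall f g, bounded_valued f -> bounded_valued g ->
    (forall x, f x <= g x) -> M f <= M g;
  mean_comp : forall f, bounded_valued f -> M (f \o T) = M f }.

Section InvariantMean.
Context (X : Type) (T : X -> X) (M : (X -> R) -> R) (HM : invariant_mean T M).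

Lemma bounded_cst (c : R) : bounded_valued (fun _ : X => c).
Proof. by exists `|c|. Qed.

Lemma bounded_indic (A : set X) : bounded_valued (\1_A : X -> R).
Proof. by exists 1 => x; rewrite indicE; case: (x \in A); rewrite ?normr1 ?normr0. Qed.

Lemma boundedD (f g : X -> R) :
  bounded_valued f -> bounded_valued g -> bounded_valued (fun x => f x + g x).
Proof.
move=> [B fB] [C gC]; exists (B + C) => x.
by rewrite (le_trans (ler_normD _ _))// lerD.
Qed.

Lemma boundedZ a (f : X -> R) :
  bounded_valued f -> bounded_valued (fun x => a * f x).
Proof. by move=> [B fB]; exists (`|a| * B) => x; rewrite normrM ler_wpM2l. Qed.

Lemma bounded_sum n (f : nat -> X -> R) : (forall i, bounded_valued (f i)) ->
  bounded_valued (fun x => \sum_(0 <= i < n) f i x).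
Proof.
move=> bf; elim: n => [|n ih].
  by under eq_fun do rewrite big_geq//; exact: bounded_cst.
by under eq_fun do rewrite big_nat_recr//=; exact: boundedD.
Qed.

Lemma meanD f g : bounded_valued f -> bounded_valued g ->
  M (fun x => f x + g x) = M f + M g.
Proof.
move=> bf bg; rewrite -[M f]mul1r -(mean_linear HM)//.
by congr M; apply/funext => x; rewrite mul1r.
Qed.

Lemma mean0 : M (fun=> 0) = 0.
Proof.
have := meanD (bounded_cst 0) (bounded_cst 0).
by under [X in M X]eq_fun do rewrite addr0; lra.
Qed.

Lemma meanZ a f : bounded_valued f -> M (fun x => a * f x) = a * M f.
Proof.
move=> bf; rewrite -[RHS]addr0 -mean0 -(mean_linear HM)//; last exact: bounded_cst.
by congr M; apply/funext => x; rewrite addr0.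
Qed.

Lemma mean_cst c : M (fun=> c) = c.
Proof.
by rewrite -[RHS]mulr1 -(mean_cst1 HM) -meanZ ?mulr1//; exact: bounded_cst.
Qed.

Lemma mean_sum n (f : nat -> X -> R) : (forall i, bounded_valued (f i)) ->
  M (fun x => \sum_(0 <= i < n) f i x) = \sum_(0 <= i < n) M (f i).
Proof.
move=> bf; elim: n => [|n ih].
  by under eq_fun do rewrite big_geq//; rewrite big_geq// mean0.
under eq_fun do rewrite big_nat_recr//=; rewrite big_nat_recr//=.
by rewrite meanD ?ih//; exact: bounded_sum.
Qed.

End InvariantMean.

(** * Invariant means under unique ergodicity *)

Lemma mean_measure_bounds (X : pmetricType R) (T : X -> X)
    (mu : probability (borelType X) R) (M : (X -> R) -> R) :
  compact [set: X] -> continuous T ->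
  (forall nu : probability (borelType X) R, invariant_measure T nu ->
     forall A : set (borelType X), measurable A -> nu A = mu A) ->
  invariant_mean T M ->
  (forall F : set X, closed F -> M \1_F <= fine (mu F)) /\
  (forall F U : set X, closed F -> open U -> F `<=` U -> fine (mu F) <= M \1_U).
Proof.
move=> Xcompact cT mu_unique HM.
(* The mean restricted to indicators is a finitely additive invariant probability; the measure [nu]
   it induces agrees with [mu] on Borel sets. *)
have [| | | |nu nuT [nuF nuU]] :=
  @exists_invariant_measure X T (fun A => M \1_A) Xcompact cT.
- move=> A; rewrite -(mean0 HM); apply: (mean_le HM); [exact: bounded_cst|exact: bounded_indic|].
  by move=> x; rewrite indicE.
- by rewrite indicT; exact: (mean_cst1 HM).
- move=> A B AB0; rewrite -(meanD HM); [|exact: bounded_indic..].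
  congr M; apply/funext => x; rewrite !indicE in_setU -natrD; congr _%:R.
  have [xA|//] := boolP (x \in A).
  have [xB|//] := boolP (x \in B).
  by exfalso; rewrite -[False]/(set0 x) -AB0; split; apply: set_mem.
- by move=> A; rewrite -(mean_comp HM (bounded_indic A)).
have mopen (U : set (borelType X)) : open (U : set X) -> measurable U.
  exact: sub_sigma_algebra.
have mclosed (F : set (borelType X)) : closed (F : set X) -> measurable F.
  by move=> cF; rewrite -[F]setCK; apply: measurableC; apply: mopen; exact: closed_openC.
split => [F cF|F U cF oU FU]; rewrite -lee_fin fineK ?fin_num_measure//; try exact: mclosed.
  by rewrite -(mu_unique _ nuT); [exact: nuF|exact: mclosed].
(* The chain is [mu F = nu F <= nu U <= M \1_U]. *)
apply: le_trans (nuU _ oU); rewrite -(mu_unique _ nuT); last exact: mclosed.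
by apply: le_measure => //; rewrite inE; [exact: mclosed|exact: mopen].
Qed.

Lemma continuous_bounded_valued (X : ptopologicalType) (f : X -> R) :
  compact [set: X] -> continuous f -> bounded_valued f.
Proof.
move=> Xcompact cf.
have := continuous_compact (continuous_subspaceT cf) Xcompact.
move=> /compact_bounded[B [_ /(_ (B + 1))]]; rewrite ltrDl ltr01 => /(_ isT) fB.
by exists (B + 1) => x; apply: fB; exists x.
Qed.

(* Layer-cake: [f + B] is the sum of the slices [min f (t i.+1) - min f (t i)],
   each squeezed between multiples of indicators of superlevel sets. *)
Lemma mean_le_mean (X : pmetricType R) (T : X -> X) (m : set X -> R)
    (M1 M2 : (X -> R) -> R) (f : X -> R) :
  invariant_mean T M1 -> invariant_mean T M2 ->
  (forall F : set X, closed F -> 0 <= m F <= 1) ->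
  (forall F : set X, closed F -> M1 \1_F <= m F) ->
  (forall F U : set X, closed F -> open U -> F `<=` U -> m F <= M2 \1_U) ->
  bounded_valued f -> continuous f -> M1 f <= M2 f.
Proof.
move=> HM1 HM2 m01 M1m mM2 [B fB] cf; apply/ler_addgt0Pr => e e0.
(* Slice height: the index shift below loses at most two slices, hence [2 * d = e]. *)
pose d := e / 2; have d0 : 0 < d by rewrite divr_gt0.
have [n dn] : exists n : nat, 2 * B <= n%:R * d.
  exists (Num.truncn (2 * B / d)).+1.
  by rewrite -ler_pdivrMr// ltW// truncnS_gt.
pose t (i : nat) : R := i%:R * d - B.
have tS i : t i.+1 = t i + d by rewrite /t -natr1; ring.
pose h (i : nat) x := Num.min (f x) (t i.+1) - Num.min (f x) (t i).
pose ge (i : nat) := [set x | t i <= f x].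
pose gt (i : nat) := [set x | t i < f x].
have ge_closed i : closed (ge i).
  by apply: (@closed_comp _ _ f [set y | t i <= y]) => [x _|]; [exact: cf|exact: closed_ge].
have gt_open i : open (gt i).
  by apply: (@open_comp _ _ f [set y | t i < y]) => [x _|]; [exact: cf|exact: open_gt].
have h_le i x : h i x <= d * \1_(ge i) x.
  rewrite indicE /h tS; case: (boolP (x \in ge i)) => xi.
    by rewrite mulr1; have := set_mem xi; rewrite /ge /= => ?; rewrite !minEle; do 2 case: ifPn; lra.
  have {}xi : f x < t i by rewrite ltNge; apply: contra xi => xi; apply/mem_set.
  by rewrite mulr0 !minEle; do 2 case: ifPn; lra.
have h_ge i x : d * \1_(gt i.+1) x <= h i x.
  rewrite indicE /h tS; case: (boolP (x \in gt i.+1)) => xi.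
    by rewrite mulr1; have := set_mem xi; rewrite /gt /= tS => ?; rewrite !minEle; do 2 case: ifPn; lra.
  by rewrite mulr0 !minEle; do 2 case: ifPn; lra.
have bh i : bounded_valued (h i).
  exists d => x; rewrite /h tS ler_norml !minEle; do 2 case: ifPn; lra.
have fE x : f x = \sum_(0 <= i < n) h i x + - B.
  rewrite /h telescope_sumr//; have := fB x; rewrite ler_norml => /andP[? ?].
  (* The levels run from [t 0 = - B] to [t n >= B], so the telescoped sum is [f x - t 0]. *)
  have : f x <= t n by rewrite /t; lra.
  have : t 0%N <= f x by rewrite /t mul0r; lra.
  by move=> /min_r -> /min_l ->; rewrite /t mul0r; lra.
have ME M : invariant_mean T M -> M f = \sum_(0 <= i < n) M (h i) - B.
  move=> HM; rewrite -(mean_sum HM)// -[in RHS](mean_cst HM (- B)) -(meanD HM); last 2 first.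
  - exact: bounded_sum.
  - exact: bounded_cst.
  by congr M; apply/funext => x; exact: fE.
have M1h i : M1 (h i) <= d * m (ge i).
  apply: (@le_trans _ _ (d * M1 \1_(ge i))); last by rewrite ler_wpM2l ?M1m ?ltW.
  rewrite -(meanZ HM1); last exact: bounded_indic.
  by apply: (mean_le HM1) => //; apply: boundedZ; exact: bounded_indic.
(* The lower bound needs a closed set inside the open [gt i.+1]; one level higher, [ge i.+2] is such
   a set. *)
have M2h i : d * m (ge i.+2) <= M2 (h i).
  apply: (@le_trans _ _ (d * M2 \1_(gt i.+1))).
    apply: ler_wpM2l; first exact: ltW.
    apply: mM2 => // x.
    by rewrite /ge /gt /= [t i.+2]tS; lra.
  rewrite -(meanZ HM2); last exact: bounded_indic.
  by apply: (mean_le HM2) => //; apply: boundedZ; exact: bounded_indic.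
(* The upper and lower sums differ by an index shift of two, so only four boundary terms in [[0, 1]]
   separate them. *)
have sumE : \sum_(0 <= i < n) m (ge i) =
    \sum_(0 <= i < n) m (ge i.+2) + m (ge 0%N) + m (ge 1%N) - m (ge n) - m (ge n.+1).
  elim: n {dn fE ME} => [|k ih]; first by rewrite !big_geq//; ring.
  by rewrite !big_nat_recr//= ih; ring.
rewrite (ME M1)// (ME M2)//.
have : \sum_(0 <= i < n) M1 (h i) <= d * \sum_(0 <= i < n) m (ge i).
  by rewrite mulr_sumr; apply: ler_sum.
have : d * \sum_(0 <= i < n) m (ge i.+2) <= \sum_(0 <= i < n) M2 (h i).
  by rewrite mulr_sumr; apply: ler_sum.
have : d * (m (ge 0%N) + m (ge 1%N) - m (ge n) - m (ge n.+1)) <= d * 2.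
  apply: ler_wpM2l; first exact: ltW.
  have /andP[_ ?] := m01 _ (ge_closed 0%N); have /andP[_ ?] := m01 _ (ge_closed 1%N).
  have /andP[? _] := m01 _ (ge_closed n); have /andP[? _] := m01 _ (ge_closed n.+1).
  lra.
have -> : e = d * 2 by rewrite /d divfK.
rewrite sumE; move: (\sum_(0 <= i < n) _) (\sum_(0 <= i < n) _) (\sum_(0 <= i < n) _) => s1 s2 s3.
by rewrite !mulrDr !mulrN; lra.
Qed.

(** Both means satisfy both bounds against the same [mu], so the one-sided comparison [mean_le_mean]
    applies in either order. *)
Lemma uniquely_ergodic_mean_unique (X : pmetricType R) (T : X -> X)
    (M1 M2 : (X -> R) -> R) (f : X -> R) :
  compact [set: X] -> continuous T -> uniquely_ergodic T ->
  invariant_mean T M1 -> invariant_mean T M2 -> continuous f -> M1 f = M2 f.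
Proof.
move=> Xcompact cT [mu _ mu_unique] HM1 HM2 cf.
have bf := continuous_bounded_valued Xcompact cf.
have [M1mu muM1] := mean_measure_bounds Xcompact cT mu_unique HM1.
have [M2mu muM2] := mean_measure_bounds Xcompact cT mu_unique HM2.
have mu01 (F : set X) : closed F -> 0 <= fine (mu F) <= 1.
  move=> cF; have mF : measurable (F : set (borelType X)).
    rewrite -[F]setCK; apply: measurableC; apply: sub_sigma_algebra.
    exact: closed_openC.
  by rewrite fine_ge0//= -lee_fin fineK ?fin_num_measure// probability_le1.
apply/eqP; rewrite eq_le; apply/andP; split.
  exact: (mean_le_mean HM1 HM2 mu01 M1mu muM2).
exact: (mean_le_mean HM2 HM1 mu01 M2mu muM1).
Qed.

(** * Ultralimits of weighted averages *)

Lemma cvg_invn : (fun n => n%:R^-1) @ \oo --> (0 : R).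
Proof. by rewrite -cvg_shiftS; exact: cvg_harmonic. Qed.

(** If the preimage of a neighbourhood [A] is not in [F], then the trace of [F] on its complement is
    proper; an ultrafilter extending it contains [F], yet [f] avoids [A] along it. *)
Lemma cvg_ultra (I : Type) (V : topologicalType) (F : set_system I) (f : I -> V) (l : V) :
  Filter F ->
  (forall G, UltraFilter G -> F `<=` G -> f @ G --> l) -> f @ F --> l.
Proof.
move=> FF fG A lA; apply: contrapT => nFA.
have Fwithin : ProperFilter (within (~` (f @^-1` A)) F).
  apply: Build_ProperFilter_ex => B; rewrite /within/= => FB; apply: contrapT => B0.
  apply: nFA; apply: filterS FB => i iB; apply: contrapT => nAi.
  by apply: B0; exists i; apply: iB.
have [G [GU FG]] := ultraFilterLemma Fwithin.
have GA : G (f @^-1` A).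
  by apply: fG lA => B FB; apply: FG; apply: filterS FB.
have GnA : G (~` (f @^-1` A)) by apply: FG; apply: nearW.
by have [i []] := filter_ex (filterI GA GnA).
Qed.

(** Compactness of [[- B, B]] provides a cluster point, and along an ultrafilter a cluster point is
    a limit, since it contains either a set or its complement. *)
Lemma cvg_ultra_bounded (I : Type) (G : set_system I) (u : I -> R) :
  UltraFilter G -> bounded_valued u -> cvg (u @ G).
Proof.
move=> GU [B uB].
have [p [_ up]] : `[- B, B] `&` cluster (u @ G) !=set0.
  apply: segment_compact; apply: nearW => i.
  by rewrite /= in_itv/= -ler_norml.
apply/cvg_ex; exists p => A pA; have [//|GnA] := in_ultra_setVsetC (u @^-1` A) GU.
by have [x []] := up (~` A) A GnA pA.
Qed.

Section WeightedMean.
Context (X : Type) (T : X -> X) (x : X) (c : nat -> R) (C : R).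
Context (G : set_system nat) (GU : UltraFilter G) (oG : \oo `<=` G).
Hypothesis cC : forall n, 0 <= c n <= C.
Hypothesis c_avg : (fun N => N%:R^-1 * \sum_(0 <= n < N) c n) @ \oo --> (1 : R).
Hypothesis c_var :
  (fun N => N%:R^-1 * \sum_(0 <= n < N) `|c n.+1 - c n|) @ \oo --> (0 : R).

Lemma cvg_eventually_sub (u : nat -> R) (l : R) : u @ \oo --> l -> u @ G --> l.
Proof. by move=> ul A /ul; exact: oG. Qed.

Definition weighted_average (g : X -> R) (N : nat) : R :=
  N%:R^-1 * \sum_(0 <= n < N) c n * g (iter n T x).

Definition weighted_mean (g : X -> R) : R := lim (weighted_average g @ G).

Lemma weighted_average_bounded g :
  bounded_valued g -> bounded_valued (weighted_average g).
Proof.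
move=> [B gB]; exists (C * B) => -[|N].
  rewrite /weighted_average big_geq// mulr0 normr0 mulr_ge0//.
    by have /andP[/le_trans] := cC 0; exact.
  exact: le_trans (gB x).
rewrite /weighted_average normrM ger0_norm ?invr_ge0//.
rewrite mulrC ler_pdivrMr ?ltr0n// (le_trans (ler_norm_sum _ _ _))//.
rewrite (@le_trans _ _ (\sum_(0 <= n < N.+1) C * B))//.
  apply: ler_sum => n _; have /andP[c0 ?] := cC n.
  by rewrite normrM ler_pM// ger0_norm.
by rewrite sumr_const_nat subn0 mulr_natr.
Qed.

Lemma weighted_mean_cvg g :
  bounded_valued g -> weighted_average g @ G --> weighted_mean g.
Proof. by move=> /weighted_average_bounded /(cvg_ultra_bounded GU). Qed.

Lemma weighted_mean_lim g l : weighted_average g @ G --> l -> weighted_mean g = l.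
Proof. by move=> /cvg_lim; apply; exact: Rhausdorff. Qed.

Lemma weighted_mean_invariant : invariant_mean T weighted_mean.
Proof.
split.
- apply: weighted_mean_lim; apply: cvg_eventually_sub.
  rewrite (_ : weighted_average _ = fun N => N%:R^-1 * \sum_(0 <= n < N) c n)//.
  by apply/funext => N; congr (_ * _); apply: eq_bigr => n _; rewrite mulr1.
- move=> a f g bf bg; apply: weighted_mean_lim.
  rewrite (_ : weighted_average _ =
      fun N => a * weighted_average f N + weighted_average g N).
    exact: cvgD (cvgMl_tmp (weighted_mean_cvg bf)) (weighted_mean_cvg bg).
  apply/funext => N; rewrite /weighted_average mulrCA -mulrDr [a * _]mulr_sumr -big_split/=.
  by congr (_ * _); apply: eq_bigr => n _; ring.
- move=> f g bf bg fg; apply: ler_cvg_to (weighted_mean_cvg bf) (weighted_mean_cvg bg) _.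
  apply: nearW => N; apply: ler_wpM2l; first by rewrite invr_ge0.
  by apply: ler_sum => n _; rewrite ler_wpM2l//; have /andP[] := cC n.
- move=> f bf; apply: weighted_mean_lim.
  have diff0 : (fun N => weighted_average (f \o T) N - weighted_average f N) @ \oo --> (0 : R).
    case: bf => B fB.
    have B0 : 0 <= B := le_trans (normr_ge0 _) (fB x).
    (* The doubled term covers the two boundary terms of a summation by parts, the other one the
       variation of [c]; both vanish after division by [N]. *)
    have bnd N : `|weighted_average (f \o T) N - weighted_average f N| <=
        N%:R^-1 * (C * B *+ 2) + N%:R^-1 * (\sum_(0 <= n < N) `|c n.+1 - c n|) * B.
      rewrite /weighted_average -mulrBr normrM ger0_norm ?invr_ge0// -mulrA -mulrDr.
      apply: ler_wpM2l; first by rewrite invr_ge0.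
      (* Summation by parts transfers the shift along the orbit to the weights. *)
      have -> : \sum_(0 <= n < N) c n * (f \o T) (iter n T x) -
          \sum_(0 <= n < N) c n * f (iter n T x) =
          c N * f (iter N T x) - c 0 * f x -
          \sum_(0 <= n < N) (c n.+1 - c n) * f (iter n.+1 T x).
        elim: N => [|N ih]; first by rewrite !big_geq//=; ring.
        rewrite !big_nat_recr//= in ih *.
        rewrite opprD addrACA ih; ring.
      have cf n : `|c n * f (iter n T x)| <= C * B.
        by have /andP[c0 ?] := cC n; rewrite normrM ler_pM// ger0_norm.
      rewrite (le_trans (ler_normB _ _))// lerD//.
        by rewrite mulr2n (le_trans (ler_normB _ _))// lerD// (cf 0).
      rewrite (le_trans (ler_norm_sum _ _ _))// mulr_suml; apply: ler_sum => n _.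
      by rewrite normrM ler_wpM2l.
    apply/norm_cvg0P; apply: (squeeze_cvgr _ (cvg_cst 0)); last first.
      rewrite -[X in _ --> X]addr0; apply: cvgD.
        rewrite -(mul0r (C * B *+ 2)); apply: cvgMr_tmp; exact: cvg_invn.
      by rewrite -(mul0r B); apply: cvgMr_tmp; exact: c_var.
    by apply: nearW => N; rewrite normr_ge0 bnd.
  have diff0G : (fun N => weighted_average (f \o T) N - weighted_average f N) @ G --> (0 : R).
    exact: cvg_eventually_sub.
  rewrite -[weighted_mean f]add0r (_ : weighted_average (f \o T) = fun N =>
    weighted_average (f \o T) N - weighted_average f N + weighted_average f N).
    exact: cvgD diff0G (weighted_mean_cvg bf).
  by apply/funext => N; rewrite subrK.
Qed.

End WeightedMean.

(** * The sign of the integer square root *)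

(** The root grows by at most one per step; this recursion exposes the block changes, so sums and
    variations of the sign follow by induction on the same test. *)
Fixpoint isqrt (n : nat) : nat :=
  if n is m.+1 then
    if ((isqrt m).+1 ^ 2 <= m.+1)%N then (isqrt m).+1 else isqrt m
  else 0.

Lemma isqrt_bounds n : (isqrt n ^ 2 <= n < (isqrt n).+1 ^ 2)%N.
Proof.
elim: n => //= n /andP[lb ub].
case: ifPn => [->/=|]; last by rewrite -ltnNge => ->; rewrite (leq_trans lb).
by rewrite (leq_ltn_trans ub)// ltn_exp2r.
Qed.

Definition sqrt_sign (n : nat) : R := (-1) ^+ isqrt n.

(** With [j = isqrt n], the complete blocks have lengths [2 * i + 1] and alternating signs, so they
    add up to [- (-1) ^+ j * j]; the current block contributes [(-1) ^+ j * (n - j ^ 2)]. *)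
Lemma sum_sqrt_sign n : \sum_(0 <= k < n) sqrt_sign k =
  (-1) ^+ isqrt n * (n%:R - (isqrt n)%:R ^+ 2 - (isqrt n)%:R).
Proof.
elim: n => [|n ih]; first by rewrite big_geq//= expr0n/=; ring.
rewrite big_nat_recr//= ih /sqrt_sign; have /andP[lb ub] := isqrt_bounds n.
case: ifPn => [le|_]; last by rewrite -natr1; ring.
(* A new block can only start exactly at a perfect square. *)
have /(congr1 (fun k : nat => k%:R : R)) : n.+1 = ((isqrt n).+1 ^ 2)%N.
  by apply/eqP; rewrite eqn_leq ub le.
rewrite -natr1 natrX -natr1 => nE.
have -> : n%:R = ((isqrt n)%:R + 1) ^+ 2 - 1 :> R by rewrite -nE; ring.
by rewrite [_ ^+ (isqrt n).+1]exprS; ring.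
Qed.

(** With [j = isqrt n], [j ^ 2 <= n <= j ^ 2 + 2 * j] puts [n - j ^ 2 - j] between [- j] and [j]. *)
Lemma norm_sum_sqrt_sign n : `|\sum_(0 <= k < n) sqrt_sign k| <= (isqrt n)%:R.
Proof.
rewrite sum_sqrt_sign normrM normrX normrN1 expr1n mul1r.
have /andP[lb ub] := isqrt_bounds n.
have {}ub : (n <= isqrt n ^ 2 + 2 * isqrt n)%N.
  by rewrite -ltnS (leq_trans ub)// -addn1 sqrnD; lia.
move: lb ub; rewrite -(ler_nat R) natrX -(ler_nat R) natrD natrX natrM.
by rewrite ler_norml; lra.
Qed.

(** The sign flips exactly when the root increases, and each flip costs 2. *)
Lemma variation_sqrt_sign n :
  \sum_(0 <= k < n) `|sqrt_sign k.+1 - sqrt_sign k| = (isqrt n)%:R *+ 2.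
Proof.
elim: n => [|n ih]; first by rewrite big_geq//= mul0rn.
rewrite big_nat_recr//= ih /sqrt_sign/=; case: ifPn => _; last first.
  by rewrite subrr normr0 addr0.
rewrite exprS mulN1r -opprD normrN -mulr2n normrMn normrX normrN1 expr1n.
by rewrite -mulrnDl natr1.
Qed.

Lemma isqrt_div_cvg0 : (fun n => n%:R^-1 * (isqrt n)%:R) @ \oo --> (0 : R).
Proof.
have : (fun n : nat => Num.sqrt (n%:R^-1)) @ \oo --> (0 : R).
  rewrite -[X in _ --> X]sqrtr0; apply: cvg_comp (cvg_invn) _.
  exact: sqrt_continuous.
apply: squeeze_cvgr; last exact: (cvg_cst 0).
apply: nearW => n; rewrite mulr_ge0 ?invr_ge0//=.
have [->|n0] := posnP n; first by rewrite invr0 mul0r sqrtr_ge0.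
(* After squaring, the bound by [Num.sqrt n%:R^-1] becomes [isqrt n ^ 2 <= n]. *)
rewrite -[leLHS]ger0_norm ?mulr_ge0 ?invr_ge0// -sqrtr_sqr ler_sqrt ?invr_ge0//.
rewrite exprMn expr2 -mulrA ger_pMr ?invr_gt0 ?ltr0n// mulrC ler_pdivrMr ?ltr0n//.
by rewrite mul1r -natrX ler_nat; have /andP[] := isqrt_bounds n.
Qed.

Lemma average_sqrt_sign_cvg0 :
  (fun N => N%:R^-1 * \sum_(0 <= n < N) sqrt_sign n) @ \oo --> (0 : R).
Proof.
apply/norm_cvg0P; apply: squeeze_cvgr (cvg_cst 0) isqrt_div_cvg0.
apply: nearW => n; rewrite normr_ge0/= normrM ger0_norm ?invr_ge0//.
by rewrite ler_wpM2l ?invr_ge0// norm_sum_sqrt_sign.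
Qed.

(** Meant for [s = 1] and [s = -1], these are the hypotheses of the weighted mean; the last two
    reduce to [isqrt n / n] tending to 0. *)
Lemma perturbed_weight (s : R) : `|s| <= 1 ->
  let c n := 1 + s * sqrt_sign n in
  [/\ forall n, 0 <= c n <= 2,
     (fun N => N%:R^-1 * \sum_(0 <= n < N) c n) @ \oo --> (1 : R) &
     (fun N => N%:R^-1 * \sum_(0 <= n < N) `|c n.+1 - c n|) @ \oo --> (0 : R)].
Proof.
move=> s1 c; split.
- move=> n; have : `|s * sqrt_sign n| <= 1.
    by rewrite normrM normrX normrN1 expr1n mulr1.
  by rewrite ler_norml /c; lra.
- have : (fun N : nat => 1 + s * (N%:R^-1 * \sum_(0 <= n < N) sqrt_sign n)) @ \oo --> (1 : R).
    rewrite -[X in _ --> X]addr0 -[X in _ --> _ + X](mulr0 s).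
    apply: cvgD; first exact: cvg_cst.
    by apply: cvgMl_tmp; exact: average_sqrt_sign_cvg0.
  apply: cvg_trans; apply: near_eq_cvg; near=> N.
  have N0 : N%:R != 0 :> R by rewrite pnatr_eq0 -lt0n; near: N; exact: nbhs_infty_gt.
  rewrite /c big_split/= sumr_const_nat subn0 mulrDr mulVf// -mulr_sumr.
  by rewrite mulrCA.
- rewrite (_ : (fun _ => _) = fun N : nat => `|s| * ((N%:R^-1 * (isqrt N)%:R) *+ 2)).
    rewrite -[X in _ --> X](mulr0 `|s|); apply: cvgMl_tmp.
    by rewrite -(mul0rn _ 2); apply: cvgMn; exact: isqrt_div_cvg0.
  apply/funext => N; rewrite -mulrnAr -variation_sqrt_sign [RHS]mulrCA [in RHS]mulr_sumr.
  by congr (_ * _); apply: eq_bigr => n _; rewrite -normrM; congr `|_|; rewrite /c; ring.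
Unshelve. all: by end_near. Qed.

Lemma sqrt_sign_orthogonal (X : pmetricType R) (T : X -> X) (f : X -> R) (x : X) :
  compact [set: X] -> continuous T -> uniquely_ergodic T -> continuous f ->
  weighted_average T x sqrt_sign f @ \oo --> (0 : R).
Proof.
move=> Xcompact cT Tue cf; apply: cvg_ultra => G GU oG.
have bf := continuous_bounded_valued Xcompact cf.
have normN1 : `|-1| <= 1 :> R by rewrite normrN1.
have norm1 : `|1| <= 1 :> R by rewrite normr1.
have [cb c1 c0] := perturbed_weight norm1.
have [db d1 d0] := perturbed_weight normN1.
have Mc := weighted_mean_invariant T x GU oG cb c1 c0.
have Md := weighted_mean_invariant T x GU oG db d1 d0.
have := cvgB (weighted_mean_cvg (T := T) (x := x) GU cb bf) (weighted_mean_cvg (T := T) (x := x) GU db bf).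
rewrite (uniquely_ergodic_mean_unique Xcompact cT Tue Mc Md cf) subrr => cd.
(* The sign [w] is recovered as half of [(1 + w) - (1 - w)], and the two weights have equal means on
   [f]. *)
rewrite -(mulr0 2^-1) (_ : weighted_average _ _ _ _ = fun N => 2^-1 *
  (weighted_average T x (fun n => 1 + 1 * sqrt_sign n) f N -
   weighted_average T x (fun n => 1 + -1 * sqrt_sign n) f N)).
  by apply: cvgMl_tmp; exact: cd.
apply/funext => N; rewrite /weighted_average -mulrBr mulrCA; congr (_ * _).
rewrite -sumrB mulr_sumr; apply: eq_bigr => n _.
by field.
Qed.

(** * Passage to complex values and conclusion *)

Lemma normc_le_ReIm (z : R[i]) : modC z <= `|complex.Re z| + `|complex.Im z|.
Proof.
case: z => a b /=; rewrite -[leRHS]ger0_norm ?addr_ge0// -sqrtr_sqr ler_wsqrtr//.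
rewrite sqrrD !real_normK ?num_real// addrAC lerDl.
by rewrite mulrn_wge0// mulr_ge0.
Qed.

Lemma ReIm_le_normc (z : R[i]) :
  (`|complex.Re z| <= modC z) /\ (`|complex.Im z| <= modC z).
Proof.
case: z => a b /=; rewrite -!sqrtr_sqr.
by split; rewrite ler_wsqrtr// ?lerDl ?lerDr sqr_ge0.
Qed.

Lemma continuous_Re_Im (X : topologicalType) (f : X -> R[i]^o) : continuous f ->
  continuous (fun x => complex.Re (f x : R[i])) /\
  continuous (fun x => complex.Im (f x : R[i])).
Proof.
move=> cf; split=> x; apply/cvgrPdist_lt => e e0.
  (* The norm of [R[i]] takes values in [R[i]], so the radius is embedded there, and distances are
     brought back to the real modulus. *)
  have e0' : (0 : R[i]) < e%:C%C by rewrite ltcR.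
  have /cvgrPdist_lt /(_ _ e0') := cf x; apply: filterS => y.
  rewrite -[ltLHS]/((modC (f x - f y : R[i]))%:C%C) ltcR; apply: le_lt_trans.
  rewrite -raddfB; exact: (ReIm_le_normc (f x - f y)).1.
have e0' : (0 : R[i]) < e%:C%C by rewrite ltcR.
have /cvgrPdist_lt /(_ _ e0') := cf x; apply: filterS => y.
rewrite -[ltLHS]/((modC (f x - f y : R[i]))%:C%C) ltcR; apply: le_lt_trans.
rewrite -raddfB; exact: (ReIm_le_normc (f x - f y)).2.
Qed.

Lemma sqrt_sign_nontrivial : nontrivial_weight (fun n => (sqrt_sign n)%:C%C : R[i]).
Proof.
have w1 n : modC ((sqrt_sign n)%:C%C : R[i]) = 1.
  by rewrite /= expr0n/= addr0 sqrtr_sqr normrX normrN1 expr1n.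
split; first by exists 1 => n; rewrite w1.
rewrite (_ : (fun N => _) = fun N : nat => (N%:R^-1 * N%:R : R)%:E); last first.
  apply/funext => N; under eq_bigr do rewrite w1.
  by rewrite sumr_const_nat subn0.
suff u1 : (fun N : nat => (N%:R^-1 * N%:R : R)%:E) @ \oo --> 1%E.
  by rewrite (cvg_limn_einf_sup u1).2 lte01.
apply: cvg_EFin; first exact: nearW.
(* The quotient is 1 except at [N = 0], where the inverse of 0 is 0. *)
apply: (@cvg_trans _ ((fun=> 1 : R) @ \oo)); last exact: cvg_cst.
apply: near_eq_cvg; near=> N => /=.
rewrite mulVf// pnatr_eq0 -lt0n.
by near: N; exact: nbhs_infty_gt.
Unshelve. all: by end_near. Qed.

End UniquelyErgodic.

Theorem theorem1p3 (R : realType) (X : pmetricType R) (T : X -> X)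
    (Xcompact : compact [set: X]) (Tcont : continuous T)
    (Tue : uniquely_ergodic T) :
  ~ bohr_chaotic T.
Proof.
move=> /(_ _ (@sqrt_sign_nontrivial R))[f [x [cf]]].
have [cRe cIm] := continuous_Re_Im cf.
set u := (X in limn_esup X); suff u0 : u @ \oo --> 0%E.
  by rewrite (cvg_limn_einf_sup u0).2 ltxx.
apply: cvg_EFin; first exact: nearW.
have re0 := sqrt_sign_orthogonal x Xcompact Tcont Tue cRe.
have im0 := sqrt_sign_orthogonal x Xcompact Tcont Tue cIm.
set re := weighted_average _ _ _ _ in re0.
set im := weighted_average _ _ _ _ in im0.
have ub0 : (fun N => `|re N| + `|im N|) @ \oo --> (0 : R).
  by rewrite -[X in _ --> X]addr0 -(@normr0 R R); apply: cvgD; exact: cvg_norm.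
apply: squeeze_cvgr (cvg_cst 0) ub0; apply: nearW => N /=.
rewrite mulr_ge0 ?invr_ge0//=; last exact: le_trans (normr_ge0 _) (ReIm_le_normc _).1.
rewrite /re /im /weighted_average !normrM (ger0_norm (_ : 0 <= N%:R^-1)) ?invr_ge0//.
rewrite -mulrDr ler_wpM2l ?invr_ge0// (le_trans (normc_le_ReIm _))//.
(* The weight is real, so taking real or imaginary parts of the sum only affects [f]. *)
rewrite !raddf_sum/= lerD// le_eqVlt; apply/orP; left; apply/eqP; congr `|_|;
  apply: eq_bigr => n _; case: (f _) => a b /=; ring.
Qed.
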